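(* Suppose that $\mathcal{H}$ is a set of finite graphs such that either no $H\in\mathcal{H}$ contains a pair of adjacent twins, or no $H\in\mathcal{H}$ contains a pair of non-adjacent twins. Suppose also that $\mathcal{H}$ contains neither the path $P_3$ on three vertices nor its complement $\overline{P}_3$. Then the hereditary property $\mathcal{F}_{\mathcal{H}}$ of all $\mathcal{H}$-free finite graphs is uniform.
   Context: Graphs are simple and undirected. For a set $\mathcal{H}$ of finite graphs, $\mathcal{F}_{\mathcal{H}}$ denotes the hereditary property consisting of all finite graphs $G$ that contain no induced subgraph isomorphic to a graph in $\mathcal{H}$ (such $G$ are called $\mathcal{H}$-free). Membership of a graph in $\mathcal{H}$ is understood up to isomorphism. Vertices $v_1\neq v_2$ of a graph $G$ are twins if they have the same neighbourhoods in $G\setminus\{v_1,v_2\}$; twins may be adjacent or non-adjacent. A graph property $\mathcal{P}$ is a collection of finite labelled graphs closed under isomorphism; it is hereditary if every induced subgraph of a graph in $\mathcal{P}$ is in $\mathcal{P}$. A random ordering of a finite graph $G$ is a probability distribution on the set of all total orderings of $V(G)$. A consistent random ordering model on a hereditary property $\mathcal{P}$ assigns to each $G\in\mathcal{P}$ a random ordering $\mathbb{P}_G$ of $V(G)$ such that whenever $H,G\in\mathcal{P}$ and $\phi$ is an isomorphism from $H$ onto an induced subgraph of $G$, then for all $x_1,\dots,x_k\in V(H)$, $\mathbb{P}_H(x_1<x_2<\dots<x_k)=\mathbb{P}_G(\phi(x_1)<\phi(x_2)<\dots<\phi(x_k))$. The uniform model takes $\mathbb{P}_G$ to be the uniform distribution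 on all $|V(G)|!$ orderings for each $G\in\mathcal{P}$; it is consistent. The property $\mathcal{P}$ is called uniform if the uniform model is the only consistent random ordering model on $\mathcal{P}$. *)

(* Defs.v *)
From HB Require Import structures.
From mathcomp Require Import all_boot all_order all_algebra.
From mathcomp Require Import reals.

Set Implicit Arguments.
Unset Strict Implicit.
Unset Printing Implicit Defensive.

Import Order.TTheory GRing.Theory Num.Theory.
Local Open Scope ring_scope.

Record sgraph := SGraph {
  vertex :> finType;
  adj : rel vertex;
  adj_sym : symmetric adj;
  adj_irr : irreflexive adj }.

(* [embedding f] : f is an isomorphism from H onto an induced subgraph of G. *)
Definition embedding (H G : sgraph) (f : H -> G) : Prop :=
  injective f /\ forall x y, adj (f x) (f y) = adj x y.

Definition isomorphic (H G : sgraph) : Prop :=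
  exists2 f : H -> G, embedding f & bijective f.

Definition contains_induced (G H : sgraph) : Prop :=
  exists f : H -> G, embedding f.

Definition twins (G : sgraph) (v1 v2 : G) : Prop :=
  v1 != v2 /\ forall w, w != v1 -> w != v2 -> adj v1 w = adj v2 w.

Definition has_adjacent_twins (G : sgraph) : Prop :=
  exists v1 v2 : G, twins v1 v2 /\ adj v1 v2.

Definition has_nonadjacent_twins (G : sgraph) : Prop :=
  exists v1 v2 : G, twins v1 v2 /\ ~~ adj v1 v2.

Section Path.
Variable n : nat.

Definition path_adj : rel 'I_n := fun i j => (i.+1 == j) || (j.+1 == i).

Lemma path_adj_sym : symmetric path_adj.
Proof. by move=> i j; rewrite /path_adj orbC. Qed.

Lemma path_adj_irr : irreflexive path_adj.
Proof. by move=> i; rewrite /path_adj orbb gtn_eqF. Qed.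

Definition path_graph : sgraph := SGraph path_adj_sym path_adj_irr.
End Path.

Section Complement.
Variable G : sgraph.

Definition compl_adj : rel G := fun x y => (x != y) && ~~ adj x y.

Lemma compl_adj_sym : symmetric compl_adj.
Proof. by move=> x y; rewrite /compl_adj eq_sym adj_sym. Qed.

Lemma compl_adj_irr : irreflexive compl_adj.
Proof. by move=> x; rewrite /compl_adj eqxx. Qed.

Definition complement : sgraph := SGraph compl_adj_sym compl_adj_irr.
End Complement.

(* Sets of finite graphs are predicates on [sgraph], not assumed closed under
   isomorphism; membership is tested up to isomorphism. *)
Definition mem_upto_iso (HH : sgraph -> Prop) (G : sgraph) : Prop :=
  exists2 H, HH H & isomorphic H G.

(* [hp_closed] covers both closure under isomorphism and closure under taking
   induced subgraphs. *)
Record hereditary_property := HereditaryProperty {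
  hp_mem :> sgraph -> Prop;
  hp_closed : forall G H, hp_mem G -> contains_induced G H -> hp_mem H }.

Definition is_free (HH : sgraph -> Prop) (G : sgraph) : Prop :=
  forall H, HH H -> ~ contains_induced G H.

Lemma is_free_closed (HH : sgraph -> Prop) (G H : sgraph) :
  is_free HH G -> contains_induced G H -> is_free HH H.
Proof.
move=> freeG [f [f_inj f_adj]] K HHK [g [g_inj g_adj]].
apply: (freeG K HHK); exists (f \o g); split; first exact: inj_comp.
by move=> x y; rewrite /= f_adj g_adj.
Qed.

Definition free_property (HH : sgraph -> Prop) : hereditary_property :=
  HereditaryProperty (@is_free_closed HH).

(* Total orderings, in strict form: (x, y) \in r means x < y. *)
Definition strict_total (T : finType) (r : {set T * T}) : bool :=
  [&& [forall x, (x, x) \notin r],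
      [forall x, forall y, forall z,
         ((x, y) \in r) && ((y, z) \in r) ==> ((x, z) \in r)]
    & [forall x, forall y, (x != y) ==> ((x, y) \in r) || ((y, x) \in r)]].

Definition ordering (T : finType) : finType :=
  {r : {set T * T} | strict_total r}.

Definition olt (T : finType) (o : ordering T) : rel T :=
  fun x y => (x, y) \in val o.

Lemma ordering_gt0 (T : finType) : (0 < #|ordering T|)%N.
Proof.
pose r : {set T * T} := [set p | (enum_rank p.1 < enum_rank p.2)%N].
suff r_total : strict_total r.
  by apply/card_gt0P; exists (Sub r r_total : ordering T).
apply/and3P; split.
- by apply/forallP => x; rewrite inE ltnn.
- apply/forallP => x; apply/forallP => y; apply/forallP => z; rewrite !inE.
  by apply/implyP => /andP[]; apply: ltn_trans.
apply/forallP => x; apply/forallP => y; apply/implyP.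
by rewrite !inE /= -neq_ltn; apply: contra_neq => /val_inj/enum_rank_inj.
Qed.

Section RandomOrdering.
Variable R : realType.

Record random_ordering (T : finType) := RandomOrdering {
  mass :> ordering T -> R;
  mass_ge0 : forall o, 0 <= mass o;
  mass_sum1 : \sum_o mass o = 1 }.

(* P(x_1 < x_2 < ... < x_k) for s = [:: x_1; ...; x_k]. *)
Definition prob_increasing (T : finType) (P : random_ordering T) (s : seq T)
  : R := \sum_(o : ordering T | sorted (olt o) s) P o.

Definition uniform_mass (T : finType) (_ : ordering T) : R :=
  #|ordering T|%:R^-1.

Lemma uniform_mass_ge0 (T : finType) (o : ordering T) : 0 <= uniform_mass o.
Proof. by rewrite invr_ge0 ler0n. Qed.

Lemma uniform_mass_sum1 (T : finType) : \sum_(o : ordering T) uniform_mass o = 1.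
Proof.
rewrite sumr_const -[RHS](@divff _ #|ordering T|%:R) ?mulr_natl //.
by rewrite pnatr_eq0 -lt0n ordering_gt0.
Qed.

Definition uniform_ordering (T : finType) : random_ordering T :=
  RandomOrdering (@uniform_mass_ge0 T) (@uniform_mass_sum1 T).

Definition ordering_model (P : hereditary_property) : Type :=
  forall G : sgraph, P G -> random_ordering G.

Definition consistent (P : hereditary_property) (M : ordering_model P) : Prop :=
  forall (H G : sgraph) (PH : P H) (PG : P G) (f : H -> G), embedding f ->
  forall s : seq H,
    prob_increasing (M H PH) s = prob_increasing (M G PG) (map f s).

Definition uniform_model (P : hereditary_property) : ordering_model P :=
  fun G _ => uniform_ordering G.

Definition uniform_property (P : hereditary_property) : Prop :=
  consistent (@uniform_model P) /\
  forall M : ordering_model P, consistent M ->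
  forall (G : sgraph) (PG : P G), M G PG =1 uniform_model PG.
End RandomOrdering.

(* Main.v *)
Require Import Defs.
From mathcomp Require Import all_boot all_order all_algebra.
From mathcomp Require Import perm reals.
From mathcomp Require Import ring lra.

(** Let b be the adjacency for which no graph of HH has twins x, y with
    adj x y = b.  Substituting for vertices of an HH-free graph classes of
    clones, any two clones of the same vertex having adjacency b, keeps it
    HH-free: an induced subgraph from HH cannot use two clones of one vertex,
    as they would be twins in it, so it embeds in the original graph
    ([free_clone_closed]).  A consistent model thus gives an ordering of
    arbitrarily large clone classes, in which clones are interchangeable.
    [clone_prob PG s] is the probability that s is increasing, where the entries
    of s, possibly repeated, stand for distinct clones; consistency makes it
    depend on the adjacencies along s alone ([clone_prob_map]).

    In the limit of large classes, the clones of u behave like independent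
    samples from a random measure mu_u on the line (de Finetti), and the model
    is uniform as soon as all these measures coincide.  The finite form of
    this remark is a second moment estimate.  Take m clones of u and m clones of
    v, and let W be the difference of the numbers of those that precede a given
    vertex z.  If the probabilities of the orderings of triples satisfy

      P(u < u' < z) + P(v < v' < z) = P(u < v < z) + P(v < u < z),

    called [balanced] below, then the off-diagonal terms of E(W^2) cancel and
    E(W^2) <= m ([clone_second_moment]), so that W / m tends to 0.  Consequently
    an entry u of a chain may be replaced by v whenever u, v and each
    neighbour z of that entry in the chain are balanced
    ([clone_prob_replace]).

    It remains to see that all triples are balanced.  This holds by symmetry for
    vertices whose pairwise adjacency is b.  The remaining kind of pair occurs
    as the endpoints u, v of a path u - c - v, or of its complement when b is
    false.  As HH contains neither graph, such a triple u, c, v is available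
    in an HH-free graph as soon as some HH-free graph contains a pair of
    adjacency ~~ b ([free_path]).  There u and c are balanced against their own
    clones, and so are v and c; the resulting replacements determine the
    probabilities of all orderings of two clones of u and one of v
    ([path_triples]).  Hence all orderings of three vertices are equally likely
    ([clone_prob_triple]), every triple is balanced, and replacing the entries
    of a chain one after the other shows that all chains of a given length are
    equally likely ([clone_prob_cst]).

    Conversely, the uniform model is consistent because in it every chain of
    k distinct vertices has probability 1 / k!, whatever the graph
    ([uniform_prob]). *)

Set Implicit Arguments.
Unset Strict Implicit.
Unset Printing Implicit Defensive.

Import Order.TTheory GRing.Theory Num.Theory.
Local Open Scope ring_scope.

(** * Orderings of a finite set and their expectations *)

Section Orderings.
Variable T : finType.
Implicit Types (o : ordering T) (s : seq T).

Lemma olt_irr o : irreflexive (olt o).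
Proof. by move=> x; case/and3P: (valP o) => /forallP/(_ x)/negbTE ? _ _. Qed.

Lemma olt_trans o : transitive (olt o).
Proof.
move=> y x z xy yz; case/and3P: (valP o) => _ trans_o _.
move/forallP/(_ x)/forallP/(_ y)/forallP/(_ z)/implyP: trans_o.
by apply; apply/andP.
Qed.

Lemma olt_total o x y : x != y -> olt o x y || olt o y x.
Proof.
by move=> xy; case/and3P: (valP o) => _ _ /forallP/(_ x)/forallP/(_ y)/implyP->.
Qed.

Lemma olt_neg o x y : x != y -> olt o y x = ~~ olt o x y.
Proof.
move=> xy; have := olt_total o xy; case E: (olt o x y) => //= _.
by apply/negP => /(olt_trans E); rewrite olt_irr.
Qed.

Lemma sorted_olt_uniq o s : sorted (olt o) s -> uniq s.
Proof. exact: sorted_uniq (@olt_trans o) (@olt_irr o) s. Qed.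

(** With s extended by a first entry below everything and a last entry above
    everything, this compares w to the entry at position i of the extended
    sequence; the [implb] encodes the upper extension. *)
Definition cut o (w : T) s (i : nat) : bool :=
  if i is j.+1 then (j < size s)%N ==> olt o w (nth w s j) else false.

(** When s1 ++ s2 is increasing, w fits between s1 and s2 when it lies below the
    next entry but not below the previous one.  As the first condition follows
    from w lying below the previous entry, the indicator is a difference: this
    makes it linear in the two comparisons. *)
Lemma sorted_insert (R : pzRingType) o s1 w s2 : w \notin s1 ++ s2 ->
  (sorted (olt o) (s1 ++ w :: s2))%:R =
    (sorted (olt o) (s1 ++ s2))%:R *
    ((cut o w (s1 ++ s2) (size s1).+1)%:R - (cut o w (s1 ++ s2) (size s1))%:R)
  :> R.
Proof.
move=> w_new.
have -> : cut o w (s1 ++ s2) (size s1).+1 =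
    if s2 is z :: _ then olt o w z else true.
  rewrite /cut nth_cat size_cat ltnn subnn.
  case: s2 {w_new} => [|z s2] /=; first by rewrite addn0 ltnn.
  by rewrite -[ltnLHS]addn0 ltn_add2l.
case/lastP: s1 w_new => [|s1 a] w_new.
  rewrite /= subr0; case: s2 w_new => [|z s2] _ /=; first by rewrite mulr1.
  by case: olt; rewrite /= ?mulr1 ?mulr0.
have wa : w != a.
  by apply: contraNneq w_new => ->; rewrite mem_cat mem_rcons mem_head.
have -> : cut o w (rcons s1 a ++ s2) (size (rcons s1 a)) = olt o w a.
  rewrite size_rcons /cut size_cat size_rcons nth_cat size_rcons ltnSn.
  by rewrite nth_rcons ltnn eqxx addSn ltnS leq_addr.
have sorted_rcons_cat s : sorted (olt o) (rcons s1 a ++ s) =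
    sorted (olt o) (rcons s1 a) && path (olt o) a s.
  by case: s1 {w_new} => [|b s1] //=; rewrite cat_path last_rcons.
rewrite !sorted_rcons_cat.
case: (sorted _ _); last by rewrite /= mul0r.
rewrite /= (olt_neg o wa).
case: s2 w_new => [|z s2] _ /=.
  by rewrite andbT mul1r; case: olt; rewrite /= ?subrr ?subr0.
case: (path _ z s2); rewrite !(andbT, andbF) ?mul0r //.
case wa_lt: (olt o w a) => /=.
  case az: (olt o a z); rewrite ?mul0r //.
  by rewrite (olt_trans wa_lt az) subrr mulr0.
rewrite subr0; case wz: (olt o w z); rewrite ?mulr0 //.
by rewrite (@olt_trans o w a z) ?mulr1 // olt_neg ?wa_lt.
Qed.

Definition listing o : seq T := sort (fun x y => ~~ olt o y x) (enum T).

Lemma mem_listing o x : x \in listing o.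
Proof. by rewrite mem_sort mem_enum. Qed.

Lemma listing_sorted o : sorted (olt o) (listing o).
Proof.
have /sort_sorted/(_ (enum T)) : total (fun x y => ~~ olt o y x).
  move=> x y; have [->|xy] := eqVneq x y; first by rewrite olt_irr.
  by rewrite (olt_neg o xy) negbK orbN.
have : uniq (listing o) by rewrite sort_uniq enum_uniq.
rewrite -/(listing o); case: listing => //= x s.
elim: s x => //= y s IHs x /andP[]; rewrite inE negb_or => /andP[xy xs] ys.
case/andP=> yx /IHs-> //.
by rewrite andbT -[olt _ _ _]negbK -olt_neg.
Qed.

Lemma sorted_listing o o' : sorted (olt o') (listing o) = (o' == o).
Proof.
apply/idP/eqP => [|->]; last exact: listing_sorted.
move=> o'_sorted; apply/val_inj/setP => -[x y].
have [<-|xy] := eqVneq x y.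
  by rewrite -[LHS]/(olt o' x x) -[RHS]/(olt o x x) !olt_irr.
wlog ltxy : x y xy / (index x (listing o) < index y (listing o))%N.
  move=> hwlog; have [/(hwlog _ _ xy)//|yx] :=
    ltnP (index x (listing o)) (index y (listing o)).
  have {}yx : (index y (listing o) < index x (listing o))%N.
    rewrite ltn_neqAle yx andbT; apply: contra_neq xy => eq_yx.
    by rewrite -[x](nth_index x (mem_listing o x)) -eq_yx nth_index ?mem_listing.
  rewrite -[LHS]/(olt o' x y) -[RHS]/(olt o x y).
  have yx' : y != x by rewrite eq_sym.
  by rewrite !(olt_neg _ yx') /olt hwlog.
rewrite -[LHS]/(olt o' x y) -[RHS]/(olt o x y).
have P r : sorted (olt r) (listing o) -> olt r x y.
  move=> srt; apply: (sorted_ltn_index (@olt_trans r) srt) => //;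
    exact: mem_listing.
by rewrite !P ?listing_sorted.
Qed.

End Orderings.

Section Expectation.
Variables (R : realType) (T : finType) (P : random_ordering R T).
Implicit Types (F : ordering T -> R) (s : seq T).

Definition expect F : R := \sum_o P o * F o.

Lemma prob_increasingE s :
  prob_increasing P s = expect (fun o => (sorted (olt o) s)%:R).
Proof.
rewrite /prob_increasing big_mkcond; apply: eq_bigr => o _.
by case: sorted; rewrite ?mulr1 ?mulr0.
Qed.

Lemma expect_eq F1 F2 : F1 =1 F2 -> expect F1 = expect F2.
Proof. by move=> eqF; apply: eq_bigr => o _; rewrite eqF. Qed.

Lemma expect_le F1 F2 : (forall o, F1 o <= F2 o) -> expect F1 <= expect F2.
Proof. by move=> leF; apply: ler_sum => o _; rewrite ler_wpM2l ?mass_ge0. Qed.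

Lemma expectD F1 F2 : expect (fun o => F1 o + F2 o) = expect F1 + expect F2.
Proof. by rewrite -big_split; apply: eq_bigr => o _; rewrite mulrDr. Qed.

Lemma expectZ a F : expect (fun o => a * F o) = a * expect F.
Proof. by rewrite mulr_sumr; apply: eq_bigr => o _; rewrite mulrCA. Qed.

Lemma expectB F1 F2 : expect (fun o => F1 o - F2 o) = expect F1 - expect F2.
Proof. by rewrite -sumrB; apply: eq_bigr => o _; rewrite mulrBr. Qed.

Lemma expect_cst a : expect (fun=> a) = a.
Proof. by rewrite /expect -mulr_suml mass_sum1 mul1r. Qed.

Lemma expect_sum (I : finType) (F : I -> ordering T -> R) :
  expect (fun o => \sum_i F i o) = \sum_i expect (F i).
Proof.
by rewrite exchange_big /=; apply: eq_bigr => o _; rewrite mulr_sumr.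
Qed.

Lemma prob_listing o : prob_increasing P (listing o) = P o.
Proof. by rewrite /prob_increasing (eq_bigl _ _ (sorted_listing o)) big_pred1_eq. Qed.

(** In an ordering where s is increasing, w has exactly one place in s: by
    [sorted_insert] the indicators of the possible places telescope to 1. *)
Lemma prob_insert s w : w \notin s ->
  prob_increasing P s =
    \sum_(i < (size s).+1) prob_increasing P (take i s ++ w :: drop i s).
Proof.
move=> w_new; rewrite prob_increasingE.
under eq_bigr do rewrite prob_increasingE.
rewrite -expect_sum; apply: expect_eq => o.
transitivity ((sorted (olt o) s)%:R *
   \sum_(i < (size s).+1) ((cut o w s i.+1)%:R - (cut o w s i)%:R) : R).
  rewrite -(big_mkord xpredT (fun i => (cut o w s i.+1)%:R - (cut o w s i)%:R)).
  by rewrite telescope_sumr //= ltnn subr0 mulr1.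
rewrite mulr_sumr; apply: eq_bigr => i _.
rewrite sorted_insert cat_take_drop // size_take_min.
by rewrite (minn_idPl _) // -ltnS.
Qed.

Lemma prob_insert2 a b w : w != a -> w != b ->
  prob_increasing P [:: a; b] = prob_increasing P [:: w; a; b] +
    prob_increasing P [:: a; w; b] + prob_increasing P [:: a; b; w].
Proof.
move=> wa wb; rewrite (@prob_insert _ w) ?inE ?negb_or ?wa //.
by rewrite !big_ord_recl big_ord0 /= addr0 addrA.
Qed.

Lemma prob_both_below a b z : uniq [:: a; b; z] ->
  expect (fun o => (olt o a z)%:R * (olt o b z)%:R) =
    prob_increasing P [:: a; b; z] + prob_increasing P [:: b; a; z].
Proof.
rewrite /= !inE !negb_or => /andP[/andP[ab az] /andP[bz _]].
rewrite !prob_increasingE -expectD; apply: expect_eq => o /=.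
rewrite !andbT (olt_neg o ab).
case E: (olt o a b); case Ea: (olt o a z); case Eb: (olt o b z);
  rewrite /= ?(mulr0, mul0r, mulr1, addr0, add0r) //.
- by move: Ea; rewrite (olt_trans E Eb).
- by move: Eb; rewrite (@olt_trans _ o a) // olt_neg ?E.
Qed.

(** By exchangeability the size s + 1 insertions of w in s are equally likely,
    and they partition the event that s is increasing. *)
Lemma exchangeable_prob s :
    (forall (pi : {perm T}) t, prob_increasing P (map pi t) = prob_increasing P t) ->
  uniq s -> prob_increasing P s = (size s)`!%:R^-1.
Proof.
move=> P_exch; elim: s => [|w s IHs] /=.
  by move=> _; rewrite prob_increasingE /= expect_cst fact0 invr1.
case/andP=> w_new s_uniq; rewrite factS natrM invfM -IHs // (prob_insert w_new).
have swap s1 a s2 : uniq (w :: s1 ++ a :: s2) ->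
    prob_increasing P (rcons s1 a ++ w :: s2) = prob_increasing P (s1 ++ w :: a :: s2).
  rewrite /= (perm_uniq (permEl (perm_catCA s1 [:: a] s2))) /= !mem_cat inE.
  rewrite !negb_or => /and3P[/and3P[ws1 _ ws2] /andP[as1 as2] _].
  have out t : w \notin t -> a \notin t -> map (tperm w a) t = t.
    move=> wt at_; rewrite -[RHS]map_id; apply/eq_in_map => x xt.
    by rewrite tpermD //; [apply: contraNneq wt|apply: contraNneq at_] => ->.
  by rewrite -[RHS](P_exch (tperm w a)) !map_cat /= tpermL tpermR !out // cat_rcons.
have front s1 s2 : uniq (w :: s1 ++ s2) ->
    prob_increasing P (s1 ++ w :: s2) = prob_increasing P (w :: s1 ++ s2).
  elim/last_ind: s1 s2 => // s1 a IH s2 uniq_s.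
  by rewrite swap ?IH -?cat_rcons.
under eq_bigr => i _ do rewrite front ?cat_take_drop /= ?w_new //.
by rewrite sumr_const card_ord -[prob_increasing _ _ *+ _]mulr_natl mulKf ?pnatr_eq0.
Qed.

End Expectation.

Section Uniform.
Variable R : realType.

Lemma relabel_total (T : finType) (pi : {perm T}) (o : ordering T) :
  strict_total [set p | (pi p.1, pi p.2) \in val o].
Proof.
apply/and3P; split.
- by apply/forallP => x; rewrite inE /= -/(olt o _ _) olt_irr.
- apply/forallP => x; apply/forallP => y; apply/forallP => z; rewrite !inE /=.
  by apply/implyP => /andP[]; apply: (@olt_trans _ o).
apply/forallP => x; apply/forallP => y; apply/implyP; rewrite !inE /= => xy.
by apply: (olt_total o); rewrite (inj_eq perm_inj).
Qed.

Definition relabel (T : finType) (pi : {perm T}) (o : ordering T) : ordering T :=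
  Sub _ (relabel_total pi o).

Lemma olt_relabel (T : finType) (pi : {perm T}) o x y :
  olt (relabel pi o) x y = olt o (pi x) (pi y).
Proof. by rewrite /olt inE. Qed.

Lemma relabel_inj (T : finType) (pi : {perm T}) : injective (relabel pi).
Proof.
move=> o1 o2 eq_o; apply/val_inj/setP => -[x y].
have := olt_relabel pi o1 (pi^-1%g x) (pi^-1%g y).
by rewrite eq_o olt_relabel !permKV => /esym.
Qed.

Lemma uniform_prob (T : finType) (s : seq T) : uniq s ->
  prob_increasing (uniform_ordering R T) s = (size s)`!%:R^-1.
Proof.
apply: exchangeable_prob => pi t.
rewrite /prob_increasing [RHS](reindex_inj (@relabel_inj T pi)) /=.
apply: eq_bigl => o; rewrite sorted_map.
by apply: eq_sorted => x y; rewrite olt_relabel.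
Qed.

Lemma uniform_consistent (P : hereditary_property) :
  consistent (@uniform_model R P).
Proof.
move=> H G PH PG f [f_inj _] s.
have [s_uniq|s_dup] := boolP (uniq s).
  by rewrite !uniform_prob ?map_inj_uniq ?size_map.
rewrite /prob_increasing !big_pred0 // => o.
  apply/negP => /sorted_olt_uniq; rewrite map_inj_uniq //; exact/negP.
by apply/negP => /sorted_olt_uniq; exact/negP.
Qed.
End Uniform.

(** * Clone graphs and chain probabilities *)

Section CloneGraph.
Variables (b : bool) (G : sgraph).

(** The adjacency of two distinct clones, one of x and one of y. *)
Definition clone_adj : rel G := fun x y => if x == y then b else adj x y.

Lemma clone_adj_sym : symmetric clone_adj.
Proof. by move=> x y; rewrite /clone_adj eq_sym adj_sym. Qed.

Lemma clone_adjxx x : clone_adj x x = b.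
Proof. by rewrite /clone_adj eqxx. Qed.

Variables (K : finType) (f : K -> G).

Definition clone_graph_adj : rel K :=
  fun i j => (i != j) && clone_adj (f i) (f j).

Lemma clone_graph_adj_sym : symmetric clone_graph_adj.
Proof. by move=> i j; rewrite /clone_graph_adj eq_sym clone_adj_sym. Qed.

Lemma clone_graph_adj_irr : irreflexive clone_graph_adj.
Proof. by move=> i; rewrite /clone_graph_adj eqxx. Qed.

(** A vertex i of K is seen as a clone of f i; an injective f gives back an
    induced subgraph of G, and the first projection of G * 'I_m the graph in
    which each vertex has m clones. *)
Definition clone_graph : sgraph := SGraph clone_graph_adj_sym clone_graph_adj_irr.
End CloneGraph.

Section CloneModel.
Variables (b : bool) (P : hereditary_property).
Hypothesis clone_closed : forall (G : sgraph) (K : finType) (f : K -> G),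
  P G -> P (clone_graph b f).
Variables (R : realType) (M : ordering_model R P).
Hypothesis M_consistent : consistent M.

Definition clone_prob (G : sgraph) (PG : P G) (s : seq G) : R :=
  prob_increasing (M (clone_closed (tnth (in_tuple s)) PG)) (enum 'I_(size s)).

Lemma map_tnth_in_tuple (T : Type) (s : seq T) :
  map (tnth (in_tuple s)) (enum 'I_(size s)) = s.
Proof. exact: map_tnth_enum (in_tuple s). Qed.

(** Whatever the clone graph in which a chain of distinct clones is read, it
    induces on that chain the clone graph of its labels. *)
Lemma clone_probE (G : sgraph) (PG : P G) (K : finType) (f : K -> G) t :
    uniq t ->
  prob_increasing (M (clone_closed f PG)) t = clone_prob PG (map f t).
Proof.
move=> t_uniq; pose s := map f t.
pose h n (size_n : n = size t) i : K := tnth (in_tuple t) (cast_ord size_n i).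
have map_h n (size_n : n = size t) : map (h n size_n) (enum 'I_n) = t.
  case: _ / (esym size_n) (size_n) => e; rewrite -[RHS]map_tnth_in_tuple.
  by apply: eq_map => i; rewrite /h cast_ord_id.
have size_s : size s = size t by rewrite size_map.
have h_inj : injective (h _ size_s).
  move=> i j; rewrite /h !(tnth_nth (h _ size_s i)) => /eqP.
  by rewrite nth_uniq //= -?size_s // => /eqP/val_inj.
have f_h i : tnth (in_tuple s) i = f (h _ size_s i).
  pose k := h _ size_s i; rewrite (tnth_nth (f k)) /= (nth_map k) -?size_s //.
  by rewrite /h (tnth_nth k).
have h_emb : @embedding (clone_graph b (tnth (in_tuple s))) (clone_graph b f)
    (h _ size_s).
  by split=> // i j; rewrite /= /clone_graph_adj (inj_eq h_inj) !f_h.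
rewrite /clone_prob (M_consistent _ (clone_closed f PG) h_emb).
by congr prob_increasing; rewrite map_h.
Qed.

(** The letters of s are abstract vertices, read in G through phi and in G'
    through phi'; repeated letters are allowed. *)
Lemma clone_prob_map (L : Type) (G G' : sgraph) (PG : P G) (PG' : P G')
    (phi : L -> G) (phi' : L -> G') :
    (forall a c, clone_adj b (phi a) (phi c) = clone_adj b (phi' a) (phi' c)) ->
  forall s, clone_prob PG (map phi s) = clone_prob PG' (map phi' s).
Proof.
move=> eq_adj s; pose g := tnth (in_tuple s).
have mapE (T : Type) (F : L -> T) : map F s = map (F \o g) (enum 'I_(size s)).
  by rewrite map_comp map_tnth_in_tuple.
rewrite !mapE -!clone_probE ?enum_uniq //.
have id_emb : @embedding (clone_graph b (phi \o g)) (clone_graph b (phi' \o g)) id.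
  by split=> // i j; rewrite /= /clone_graph_adj /= eq_adj.
by rewrite (M_consistent _ (clone_closed (phi' \o g) PG') id_emb) map_id.
Qed.

Lemma clone_prob_uniq (G : sgraph) (PG : P G) s : uniq s ->
  clone_prob PG s = prob_increasing (M PG) s.
Proof.
move=> s_uniq; rewrite -[in LHS](map_id s) -clone_probE //.
have id_emb : @embedding (clone_graph b (@id G)) G id.
  split=> // i j; rewrite /= /clone_graph_adj /clone_adj.
  by case: eqVneq => //= ->; rewrite adj_irr.
by rewrite (M_consistent _ PG id_emb) map_id.
Qed.

Lemma clone_prob_insert2 (G : sgraph) (PG : P G) (x y z : G) :
  clone_prob PG [:: x; y] = clone_prob PG [:: z; x; y] +
    clone_prob PG [:: x; z; y] + clone_prob PG [:: x; y; z].
Proof.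
pose phi (i : 'I_3) := nth x [:: x; y; z] i.
pose i0 : 'I_3 := inord 0; pose i1 : 'I_3 := inord 1; pose i2 : 'I_3 := inord 2.
have [e0 e1 e2] : [/\ phi i0 = x, phi i1 = y & phi i2 = z].
  by rewrite /phi !inordK.
have ne i j : (i < 3)%N -> (j < 3)%N -> i != j -> (inord i : 'I_3) != inord j.
  by move=> i3 j3; apply: contra_neq => /(congr1 val); rewrite /= !inordK.
have := prob_insert2 (M (clone_closed phi PG))
  (ne 2 0 isT isT isT) (ne 2 1 isT isT isT).
rewrite !clone_probE /= ?inE ?negb_or ?ne // -/i0 -/i1 -/i2.
by rewrite e0 e1 e2.
Qed.

(** In terms of the numbers U and V of clones of u and v that precede z, out of
    many, this says that E(U^2 + V^2 - 2UV) vanishes to leading order. *)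
Definition balanced (G : sgraph) (PG : P G) (u v z : G) : Prop :=
  clone_prob PG [:: u; u; z] + clone_prob PG [:: v; v; z] =
  clone_prob PG [:: u; v; z] + clone_prob PG [:: v; u; z].

(** The vertices [inl a] serve as thresholds to which the m clones [X i] of u
    and the m clones [Y i] of v are compared. *)
Section Replacement.
Variables (G : sgraph) (PG : P G) (u v : G) (A : finType) (g : A -> G) (m : nat).

Let label (k : A + 'I_m * bool) : G :=
  match k with inl a => g a | inr (_, is_u) => if is_u then u else v end.
Let X (i : 'I_m) : A + 'I_m * bool := inr (i, true).
Let Y (i : 'I_m) : A + 'I_m * bool := inr (i, false).
Let Q := M (clone_closed label PG).

(** Expanding the square, the terms with i != j have expectation 0 by
    balancedness, and the m diagonal terms are at most 1. *)
Lemma clone_second_moment (a : A) : balanced PG u v (g a) ->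
  expect Q (fun o => (\sum_(i < m)
    ((olt o (X i) (inl a))%:R - (olt o (Y i) (inl a))%:R)) ^+ 2) <= m%:R.
Proof.
move=> bal; pose z : A + 'I_m * bool := inl a.
pose x k o : R := (olt o k z)%:R.
have below k l : k != l -> k != z -> l != z ->
    expect Q (fun o => x k o * x l o) =
    clone_prob PG [:: label k; label l; g a] + clone_prob PG [:: label l; label k; g a].
  move=> kl kz lz; rewrite prob_both_below /= ?inE ?negb_or ?kl ?kz ?lz //.
  by rewrite !clone_probE //= ?inE ?negb_or ?(eq_sym l k) ?kl ?kz ?lz.
have cov i j : expect Q (fun o => (x (X i) o - x (Y i) o) * (x (X j) o - x (Y j) o))
    <= (i == j)%:R.
  case: eqVneq => [<-|ij].
    rewrite -[leRHS](expect_cst Q); apply: expect_le => o.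
    rewrite /x; do 2 case: olt; rewrite /=; lra.
  rewrite (@expect_eq _ _ _ _ (fun o =>
      (x (X i) o * x (X j) o + x (Y i) o * x (Y j) o) -
      (x (X i) o * x (Y j) o + x (Y i) o * x (X j) o))); last by move=> o; ring.
  have ne c d : (inr (i, c) : A + 'I_m * bool) != inr (j, d).
    by apply: contra_neq ij => -[].
  rewrite expectB !expectD !below ?ne //= -/z.
  move: bal; rewrite /balanced; lra.
rewrite (@expect_eq _ _ _ _ (fun o => \sum_i \sum_j
    ((x (X i) o - x (Y i) o) * (x (X j) o - x (Y j) o)))); last first.
  by move=> o; rewrite expr2 mulr_suml; apply: eq_bigr => i _; rewrite mulr_sumr.
rewrite expect_sum.
under eq_bigr do rewrite expect_sum.
apply: (@le_trans _ _ (\sum_(i < m) \sum_(j < m) (i == j)%:R)).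
  by apply: ler_sum => i _; apply: ler_sum => j _; apply: cov.
under eq_bigr => i _.
  rewrite (bigD1 i) //= eqxx big1 ?addr0; last by move=> j /negbTE; rewrite eq_sym => ->.
  over.
by rewrite sumr_const card_ord.
Qed.

End Replacement.

(** * Replacing one entry of a chain *)

(** The difference d of the two sides is an average over m clones of u and of v
    inserted at place i.  By [sorted_insert] it is 1/m times the expectation of
    W i.+1 - W i on the event that s is increasing, where W h is the number
    of those clones of u below the cut h minus the number of those of v; both
    have second moment at most m, so d is O(1 / sqrt m).  Only the entries just
    before and just after place i matter, which is what the condition
    j <= i <= j.+1 selects. *)
Lemma clone_prob_replace_le (G : sgraph) (PG : P G) (s : seq G) (i : nat)
    (u v : G) :
    (i <= size s)%N ->
    (forall j, (j < size s)%N -> (j <= i <= j.+1)%N ->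
       balanced PG u v (nth u s j)) ->
  clone_prob PG (take i s ++ u :: drop i s) <=
    clone_prob PG (take i s ++ v :: drop i s).
Proof.
move=> i_le bal; rewrite -subr_le0; set d := _ - _.
suff d_le (k : nat) : (0 < k)%N -> k%:R * d <= 2.
  rewrite leNgt; apply/negP => d_gt0.
  have /d_le := ltn0Sn (Num.bound (2 / d)).
  have := archi_boundP (divr_ge0 (ler0n R 2) (ltW d_gt0) : 0 <= 2 / d).
  rewrite ltr_pdivrMr // -natr1 mulrDl mul1r; lra.
(* For m = k ^ 2 the second moments are at most k ^ 2, so E|W| <= k. *)
move=> k_gt0; pose m := (k * k)%N; pose n := size s.
pose label (x : 'I_n + 'I_m * bool) : G := match x with
  | inl a => tnth (in_tuple s) a | inr (_, is_u) => if is_u then u else v end.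
pose Q := M (clone_closed label PG).
pose X j : 'I_n + 'I_m * bool := inr (j, true).
pose Y j : 'I_n + 'I_m * bool := inr (j, false).
pose t : seq ('I_n + 'I_m * bool) := map inl (enum 'I_n).
have label_t : map label t = s by rewrite -map_comp map_tnth_in_tuple.
have size_t : size t = n by rewrite size_map size_enum_ord.
have t_uniq : uniq t by rewrite map_inj_uniq ?enum_uniq // => ? ? [].
have new e : inr e \notin t by apply/mapP => -[].
have ins e : prob_increasing Q (take i t ++ inr e :: drop i t) =
    clone_prob PG (take i s ++ (if e.2 then u else v) :: drop i s).
  rewrite clone_probE; first by rewrite map_cat /= map_take map_drop label_t; case: e.
  rewrite -cat_rcons -cats1 -catA uniq_catCA /= cat_take_drop.
  by rewrite new t_uniq.
pose S o : R := (sorted (olt o) t)%:R.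
pose W h o : R := \sum_j ((cut o (X j) t h)%:R - (cut o (Y j) t h)%:R).
(* At the ends of the extended sequence all comparisons are trivial: W0. *)
have W_moment h : (i <= h <= i.+1)%N -> expect Q (fun o => W h o ^+ 2) <= m%:R.
  move=> /andP[i_h h_i].
  have W0 : (forall o, W h o = 0) -> expect Q (fun o => W h o ^+ 2) <= m%:R.
    move=> W0; rewrite (@expect_eq _ _ _ _ (fun=> 0)) ?expect_cst ?ler0n // => o.
    by rewrite W0 expr0n.
  case: h => [|h] in i_h h_i W0 *.
    by apply: W0 => o; rewrite /W big1 // => j; rewrite subrr.
  have [h_lt|h_ge] := ltnP h n; last first.
    apply: W0 => o; rewrite /W big1 // => j _.
    by rewrite /cut size_t ltnNge h_ge /= subrr.
  have nth_t x : nth x t h = inl (Ordinal h_lt).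
    rewrite (nth_map (Ordinal h_lt)) ?size_enum_ord //; congr inl.
    by apply: val_inj; rewrite /= nth_enum_ord.
  rewrite (@expect_eq _ _ _ _ (fun o => (\sum_j ((olt o (X j) (inl (Ordinal h_lt)))%:R
     - (olt o (Y j) (inl (Ordinal h_lt)))%:R)) ^+ 2)); last first.
    move=> o; congr (_ ^+ 2); apply: eq_bigr => j _.
    by rewrite /cut size_t h_lt /= !nth_t.
  have := clone_second_moment (g := tnth (in_tuple s)) m (a := Ordinal h_lt).
  apply; rewrite (tnth_nth u) /=; apply: bal => //; exact/andP.
have diff : m%:R * d = expect Q (fun o => S o * (W i.+1 o - W i o)).
  rewrite mulr_natl -[m in LHS]card_ord -sumr_const.
  rewrite (@expect_eq _ _ _ _ (fun o => \sum_j
     ((sorted (olt o) (take i t ++ X j :: drop i t))%:R -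
      (sorted (olt o) (take i t ++ Y j :: drop i t))%:R))).
    rewrite expect_sum; apply: eq_bigr => j _.
    by rewrite expectB -!prob_increasingE !ins.
  move=> o; rewrite /W -sumrB mulr_sumr; apply: eq_bigr => j _.
  rewrite !sorted_insert ?cat_take_drop ?new // size_takel ?size_t // -/(S o).
  ring.
(* 2k(x - y) <= x^2 + y^2 + 2k^2 avoids absolute values. *)
have : 2 * k%:R * (m%:R * d) <= m%:R + m%:R + 2 * m%:R.
  rewrite diff -expectZ; have [Wi Wi1] := (W_moment i, W_moment i.+1).
  apply: (@le_trans _ _ (expect Q (fun o => W i.+1 o ^+ 2 + W i o ^+ 2 + 2 * m%:R))).
    apply: expect_le => o; rewrite /S natrM.
    have := sqr_ge0 (W i.+1 o - k%:R); have := sqr_ge0 (W i o + k%:R).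
    case: (sorted _ _) => /=; last by rewrite mul0r mulr0; nra.
    by rewrite mul1r; nra.
  rewrite !expectD expect_cst lerD2r lerD // ?Wi ?Wi1 ?leqnn ?leqnSn //.
have k_pos : 0 < k%:R :> R by rewrite ltr0n.
have m_pos : 0 < m%:R :> R by rewrite ltr0n muln_gt0 k_gt0.
nra.
Qed.

Lemma clone_prob_replace (G : sgraph) (PG : P G) (s : seq G) (i : nat) (u v : G) :
    (i <= size s)%N ->
    (forall j, (j < size s)%N -> (j <= i <= j.+1)%N ->
       balanced PG u v (nth u s j)) ->
  clone_prob PG (take i s ++ u :: drop i s) =
    clone_prob PG (take i s ++ v :: drop i s).
Proof.
move=> i_le bal; apply/le_anti/andP; split; apply: clone_prob_replace_le => // j j_lt ij.
rewrite (set_nth_default u) //; have := bal j j_lt ij.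
by rewrite /balanced addrC => ->; rewrite addrC.
Qed.

(** * Triples of vertices *)

(** When the pairwise adjacencies of x, y and their clones are all b, chains in
    x and y look like chains of clones of one vertex z, in any graph. *)
Lemma clone_prob_homogeneous (G G' : sgraph) (PG : P G) (PG' : P G') x y z :
  clone_adj b x y = b -> forall s : seq bool,
  clone_prob PG (map (fun e => if e then x else y) s) =
    clone_prob PG' (map (fun=> z) s).
Proof.
move=> xy; apply: clone_prob_map => e e'; rewrite clone_adjxx.
by case: e e' => [] []; rewrite ?clone_adjxx ?xy // clone_adj_sym xy.
Qed.

Section Path.
Variables (T : sgraph) (PT : P T) (c u v : T).
Hypotheses (cu : clone_adj b c u = b) (cv : clone_adj b c v = b).

Notation q := (clone_prob PT).
Notation q3 := (clone_prob PT [:: c; c; c]).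

Lemma path_symmetric s :
  q (map (fun e : option bool => if e is Some e' then if e' then u else v else c) s) =
  q (map (fun e : option bool => if e is Some e' then if e' then v else u else c) s).
Proof.
have [uc vc] : clone_adj b u c = b /\ clone_adj b v c = b.
  by rewrite ![clone_adj b _ c]clone_adj_sym.
have vu : clone_adj b v u = clone_adj b u v by rewrite clone_adj_sym.
by apply: clone_prob_map => -[[]|] [[]|]; rewrite ?clone_adjxx ?(cu, cv, uc, vc, vu).
Qed.

(** Since c is balanced with u against clones of u and c, a chain v < u < u' may
    be turned into v < u < c, which is as likely as u < v < c by symmetry.
    Together with v < c < u, which may be turned into v < c < c', these two
    chains partition the event v < c, and this fixes their probability.
    The reversed argument treats u < u' < v, and the third ordering is what
    remains. *)
Lemma path_triples :
  [/\ q [:: v; u; u] = q3, q [:: u; v; u] = q3 & q [:: u; u; v] = q3].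
Proof.
have qu e1 e2 e3 := clone_prob_homogeneous PT PT c cu [:: e1; e2; e3].
have qv e1 e2 e3 := clone_prob_homogeneous PT PT c cv [:: e1; e2; e3].
have bal_u : balanced PT u c u.
  by congr (_ + _); [rewrite (qu false false false) (qu false true false)
                    |rewrite (qu true true false) (qu true false false)].
have bal_c : balanced PT u c c.
  by congr (_ + _); [rewrite (qu false false true) (qu false true true)
                    |rewrite (qu true true true) (qu true false true)].
have vuu : q [:: v; u; u] = q3.
  have E1 : q [:: v; u; u] = q [:: v; u; c].
    by apply: (@clone_prob_replace T PT [:: v; u] 2) => // -[|[|]].
  have E2 : q [:: u; v; c] = q [:: v; u; c].
    exact: path_symmetric [:: Some true; Some false; None].
  have E3 : q [:: v; c; u] = q [:: v; c; c].
    by apply: (@clone_prob_replace T PT [:: v; c] 2) => // -[|[|]].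
  have := clone_prob_insert2 PT v c u; rewrite (clone_prob_insert2 PT v c c).
  rewrite E2 E3 (qv false true true) (qv true false true) E1 /=.
  lra.
have uuv : q [:: u; u; v] = q3.
  have E1 : q [:: u; u; v] = q [:: c; u; v].
    by apply: (@clone_prob_replace T PT [:: u; v] 0) => // -[|[|]].
  have E2 : q [:: c; u; v] = q [:: c; v; u].
    exact: path_symmetric [:: None; Some true; Some false].
  have E3 : q [:: u; c; v] = q [:: c; c; v].
    by apply: (@clone_prob_replace T PT [:: c; v] 0) => // -[|[|]].
  have := clone_prob_insert2 PT c v u; rewrite (clone_prob_insert2 PT c v c).
  rewrite E3 -E2 E1 (qv true true false) (qv true false true).
  rewrite /=; lra.
split=> //; have := clone_prob_insert2 PT u u v.
rewrite (clone_prob_insert2 PT u u u) vuu uuv (qu false false false).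
by rewrite /=; lra.
Qed.

End Path.

(** Pairs of adjacency ~~ b are not accessible to cloning alone; the third
    vertex c, of adjacency b with both, mediates between them. *)
Hypothesis path_closed : forall (G : sgraph) (x y : G), P G ->
  clone_adj b x y = ~~ b ->
  exists (T : sgraph) (c u v : T), [/\ P T, clone_adj b c u = b,
    clone_adj b c v = b & clone_adj b u v = ~~ b].

Lemma pair_triples (G : sgraph) (PG : P G) (x y : G) (e1 e2 e3 : bool) :
  clone_prob PG (map (fun e => if e then x else y) [:: e1; e2; e3]) =
    clone_prob PG [:: x; x; x].
Proof.
have [xy|xy] := eqVneq (clone_adj b x y) b.
  by rewrite (clone_prob_homogeneous PG PG x xy [:: e1; e2; e3]).
have {}xy : clone_adj b x y = ~~ b by case: b (clone_adj b x y) xy => -[].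
have [T [c [u [v [PT cu cv uv]]]]] := path_closed PG xy.
rewrite (clone_prob_homogeneous PG PT c (clone_adjxx b x) [:: true; true; true]).
have xyuv e e' : clone_adj b (if e then x else y) (if e' then x else y) =
    clone_adj b (if e then u else v) (if e' then u else v).
  case: e e' => [] []; rewrite ?clone_adjxx ?xy ?uv //.
  by rewrite clone_adj_sym xy clone_adj_sym uv.
rewrite (clone_prob_map PG PT xyuv).
have [q1 q2 q3] := path_triples PT cu cv.
have [q4 q5 q6] := path_triples PT cv cu.
case: e1 e2 e3 => [] [] []; rewrite /= ?q1 ?q2 ?q3 ?q4 ?q5 ?q6 //.
  by rewrite (clone_prob_homogeneous PT PT c (clone_adjxx b u) [:: true; true; true]).
by rewrite (clone_prob_homogeneous PT PT c (clone_adjxx b v) [:: true; true; true]).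
Qed.

(** The last entry z of x < y < z may be replaced by a second clone of y, since
    this involves only triples taken from the pair y, z. *)
Lemma clone_prob_triple (G : sgraph) (PG : P G) (x y z : G) :
  clone_prob PG [:: x; y; z] = clone_prob PG [:: x; x; x].
Proof.
rewrite -(pair_triples PG x y true false false) /=.
apply: (@clone_prob_replace G PG [:: x; y] 2) => // -[|[|]] //= _ _.
have q e1 e2 e3 := pair_triples PG y z e1 e2 e3.
by congr (_ + _); [rewrite (q false false true) (q false true true)
                  |rewrite (q true false true)].
Qed.

Lemma all_balanced (G : sgraph) (PG : P G) (u v z : G) : balanced PG u v z.
Proof.
by congr (_ + _); [rewrite !(clone_prob_triple _ u)|rewrite !(clone_prob_triple _ v)].
Qed.

Lemma clone_prob_cst (G : sgraph) (PG : P G) (s s' : seq G) :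
  size s = size s' -> clone_prob PG s = clone_prob PG s'.
Proof.
move=> size_s; rewrite -[s]cat0s -[s']cat0s.
elim: s s' size_s ([::] : seq G) => [|x s IHs] [|y s'] //= [size_s] s0.
have := @clone_prob_replace G PG (s0 ++ s) (size s0) x y.
rewrite take_size_cat // drop_size_cat // => ->; first last.
- by move=> *; apply: all_balanced.
- by rewrite size_cat leq_addr.
by rewrite -!cat_rcons; apply: IHs.
Qed.

(** The mass of an ordering is the probability of the chain listing all vertices
    in that ordering. *)
Lemma model_uniform (G : sgraph) (PG : P G) : M PG =1 uniform_model R PG.
Proof.
have listing_uniq o : uniq (listing o) by rewrite sort_uniq enum_uniq.
have massE o : M PG o = clone_prob PG (listing o).
  by rewrite clone_prob_uniq // prob_listing.
move=> o; have cst o' : M PG o' = M PG o.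
  by rewrite !massE; apply: clone_prob_cst; rewrite !size_sort.
have := mass_sum1 (M PG); under eq_bigr do rewrite cst.
rewrite sumr_const -mulr_natl => sum1; apply: (mulfI _ (etrans sum1 _)).
  by rewrite pnatr_eq0 -lt0n ordering_gt0.
by rewrite divff // pnatr_eq0 -lt0n ordering_gt0.
Qed.

End CloneModel.

(** * Free properties *)

Section FreeProperty.
Variables (b : bool) (HH : sgraph -> Prop).
Hypothesis no_twins :
  forall (H : sgraph) (x y : H), HH H -> twins x y -> adj x y <> b.

(** Two vertices of H placed on clones of the same vertex would be twins of
    adjacency b, so H has at most one vertex in each clone class. *)
Lemma free_clone_closed (G : sgraph) (K : finType) (f : K -> G) :
  is_free HH G -> is_free HH (clone_graph b f).
Proof.
move=> freeG H HHH [g [g_inj g_adj]].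
have adjE x y : adj x y = (x != y) && clone_adj b (f (g x)) (f (g y)).
  by rewrite -g_adj /= /clone_graph_adj (inj_eq g_inj).
have fg_inj : injective (f \o g).
  move=> x y /= fg; apply/eqP/negPn/negP => xy; apply: (no_twins HHH (x := x) (y := y)).
    by split=> // w wx wy; rewrite !adjE fg ![_ == w]eq_sym wx wy.
  by rewrite adjE xy fg clone_adjxx.
apply: (freeG H HHH); exists (f \o g); split=> // x y; rewrite adjE /clone_adj.
rewrite -[f (g x) == _]/((f \o g) x == (f \o g) y) (inj_eq fg_inj).
by case: eqVneq => // ->; rewrite adj_irr.
Qed.

(** A graph H of HH embedded in T misses a vertex, since T is not in HH.
    If it misses c it lies on a pair of adjacency ~~ b, hence embeds in G;
    if it misses u or v, it consists of clones of a single vertex of G. *)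
Lemma free_path (T : sgraph) (c u v : T) (G : sgraph) (x y : G) :
    (forall z, [\/ z = c, z = u | z = v]) -> uniq [:: c; u; v] ->
    adj c u = b -> adj c v = b -> adj u v = ~~ b ->
    ~ mem_upto_iso HH T ->
    is_free HH G -> x != y -> adj x y = ~~ b ->
  is_free HH T.
Proof.
move=> T3 T_uniq cu cv uv noT freeG xy adj_xy H HHH [g [g_inj g_adj]].
have [cNu cNv uNv] : [/\ c != u, c != v & u != v].
  by move: T_uniq; rewrite /= !inE negb_or => /and3P[/andP[]].
have [g_onto|] := boolP [forall z, z \in codom g].
  apply: noT; exists H => //; exists g => //; apply: inj_card_bij => //.
  rewrite -(card_codom g_inj); apply: subset_leq_card.
  by apply/subsetP => z _; apply: (forallP g_onto).
case/forallPn=> z z_new; have gNz w : g w <> z.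
  by move=> gw; case/negP: z_new; rewrite -gw codom_f.
have [uc vc vu] : [/\ adj u c = b, adj v c = b & adj v u = ~~ b].
  by rewrite adj_sym cu adj_sym cv adj_sym uv.
have edge : (forall w w', g w != g w' -> adj (g w) (g w') = b) -> False.
  move=> g_b; apply: (@free_clone_closed G T (fun=> x) freeG H HHH).
  exists g; split=> // w w'; rewrite -g_adj /= /clone_graph_adj clone_adjxx.
  by case: eqVneq => [->|/g_b->] //=; rewrite adj_irr.
have [z_eq|z_eq|z_eq] := T3 z; rewrite {}z_eq in gNz.
- have g2 w : g w = u \/ g w = v by have [/gNz|->|->] := T3 (g w); auto.
  apply: (freeG H HHH); exists (fun w => if g w == u then x else y).
  split=> w w'; last first.
    rewrite -g_adj; have [->|->] := g2 w; have [->|->] := g2 w';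
      by rewrite ?eqxx ?[v == u]eq_sym ?(negbTE uNv) ?adj_irr ?uv ?vu // adj_sym.
  have [gw|gw] := g2 w; have [gw'|gw'] := g2 w';
    rewrite gw gw' ?eqxx ?[v == u]eq_sym ?(negbTE uNv) => // e.
  + by apply: g_inj; rewrite gw.
  + by rewrite e eqxx in xy.
  + by rewrite e eqxx in xy.
  + by apply: g_inj; rewrite gw.
- apply: edge => w w'.
  have [->|/gNz|->] // := T3 (g w); have [->|/gNz|->] // := T3 (g w');
    by rewrite ?eqxx ?cv ?vc.
- apply: edge => w w'.
  have [->|->|/gNz] // := T3 (g w); have [->|->|/gNz] // := T3 (g w');
    by rewrite ?eqxx ?cu ?uc.
Qed.

Lemma free_uniform (R : realType) (T : sgraph) (c u v : T) :
    (forall z, [\/ z = c, z = u | z = v]) -> uniq [:: c; u; v] ->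
    adj c u = b -> adj c v = b -> adj u v = ~~ b ->
    ~ mem_upto_iso HH T ->
  uniform_property R (free_property HH).
Proof.
move=> T3 T_uniq cu cv uv noT; split=> [|M M_cons G freeG].
  exact: uniform_consistent.
suff path_closed : forall (G' : sgraph) (x y : G'), is_free HH G' ->
    clone_adj b x y = ~~ b ->
    exists (T : sgraph) (c u v : T), [/\ is_free HH T, clone_adj b c u = b,
      clone_adj b c v = b & clone_adj b u v = ~~ b].
  exact: (@model_uniform b (free_property HH) free_clone_closed R M M_cons path_closed).
move=> {G freeG} G x y freeG.
rewrite /clone_adj; case: eqVneq => [_|xy adj_xy]; first by case: (b).
have [cNu cNv uNv] : [/\ c != u, c != v & u != v].
  by move: T_uniq; rewrite /= !inE negb_or => /and3P[/andP[]].
exists T, c, u, v; rewrite !ifN //; split=> //.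
exact: (free_path T3 T_uniq cu cv uv noT freeG xy adj_xy).
Qed.
End FreeProperty.

Theorem theorem1p5 (R : realType) (HH : sgraph -> Prop)
  (twin_free : (forall H, HH H -> ~ has_adjacent_twins H) \/
               (forall H, HH H -> ~ has_nonadjacent_twins H))
  (no_P3 : ~ mem_upto_iso HH (path_graph 3))
  (no_coP3 : ~ mem_upto_iso HH (complement (path_graph 3))) :
  uniform_property R (free_property HH).
Proof.
pose i0 : 'I_3 := ord0; pose i1 : 'I_3 := inord 1; pose i2 : 'I_3 := ord_max.
have i1E : (i1 : nat) = 1%N by rewrite inordK.
have I3 z : [\/ z = i1, z = i0 | z = i2].
  case: z => -[|[|[|//]]] lt_z; [constructor 2|constructor 1|constructor 3];
    by apply: val_inj; rewrite ?i1E.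
have I3_uniq : uniq [:: i1; i0; i2] by rewrite /= !inE -!val_eqE /= i1E.
case: twin_free => no_twins.
  apply: (@free_uniform true HH _ R (path_graph 3) i1 i0 i2) => //.
  - by move=> H x y HHH tw xy; apply: (no_twins H HHH); exists x, y.
  - by rewrite /= /path_adj i1E.
  - by rewrite /= /path_adj i1E.
apply: (@free_uniform false HH _ R (complement (path_graph 3)) i1 i0 i2) => //.
- by move=> H x y HHH tw xy; apply: (no_twins H HHH); exists x, y; rewrite xy.
- by rewrite /= /compl_adj /= /path_adj i1E andbF.
- by rewrite /= /compl_adj /= /path_adj i1E andbF.
Qed.
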